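(* Let $A=\operatorname{diag}_TA_T\in\mathbb R^{N\times N}$ be symmetric positive semidefinite and block diagonal over the triangles $T$, let $R_T$ be a matrix whose columns span $\ker A_T$, and set $A^+=\operatorname{diag}_TA_T^+$, $R=\operatorname{diag}_TR_T$, $H=CA^+C^T$, $G=CR$, where $C\in\mathbb R^{m\times N}$ and $f\in\mathbb R^N$. Then the homogeneous problem $$Ac+C^T\lambda=f,\qquad Cc=0$$ is equivalent to $$\begin{bmatrix} H & G \\ G^T & 0 \end{bmatrix} \begin{bmatrix} \lambda \\ \beta \end{bmatrix} = \begin{bmatrix} CA^+f \\ R^Tf \end{bmatrix},\qquad c=A^+(f-C^T\lambda)-R\beta,$$ in the sense that $(c,\lambda)$ solves the first problem if and only if there is $\beta$ such that $(\lambda,\beta)$ and $c$ satisfy the second. Redundant rows of $C$ give null directions in the multiplier block (for $\eta\in\ker C^T$, $(\eta,0)$ is a null vector of the block matrix), and $C$ may be replaced by a matrix $\bar C$ of full row rank with the same row space without changing $c$.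
   Context: $A_T^+$ is the Moore--Penrose pseudoinverse of $A_T$. In the paper $A$ is a broken Galerkin matrix and $C$ a smoothness matrix (nonzero constraint data having been lifted into $f$, so that the constraint is homogeneous); rows of $C$ may be linearly dependent. *)

(* Defs.v *)
From mathcomp Require Import all_boot all_order all_algebra.
From mathcomp Require Export reals.
Set Implicit Arguments.
Unset Strict Implicit.
Unset Printing Implicit Defensive.
Import Order.TTheory GRing.Theory Num.Theory.
Local Open Scope ring_scope.

(* The four Penrose equations; over a real field the adjoint is the transpose. *)
Definition is_mppinv (K : realFieldType) m n (A : 'M[K]_(m, n))
    (X : 'M[K]_(n, m)) : bool :=
  [&& A *m X *m A == A, X *m A *m X == X,
      (A *m X)^T == A *m X & (X *m A)^T == X *m A].

Lemma mulmx_tr_eq0 (K : realFieldType) n (v : 'rV[K]_n) :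
  v *m v^T = 0 -> v = 0.
Proof.
move=> /matrixP/(_ 0 0); rewrite !mxE => v0; apply/rowP => j; rewrite mxE.
have ge0 i : true -> 0 <= v 0 i * v^T i 0 by rewrite mxE -expr2 sqr_ge0.
by have /eqP := psumr_eq0P ge0 v0 (i := j) isT; rewrite mxE mulf_eq0 orbb => /eqP.
Qed.

Lemma unitmx_gram (K : realFieldType) m n (D : 'M[K]_(m, n)) :
  row_free D -> D *m D^T \in unitmx.
Proof.
move=> freeD; rewrite -row_free_unit -kermx_eq0; apply/eqP/row_matrixP => i.
rewrite row0; apply: (row_free_inj freeD); rewrite mul0mx.
apply: mulmx_tr_eq0.
by rewrite trmx_mul mulmxA -(mulmxA (row i _)) -row_mul mulmx_ker row0 mul0mx.
Qed.

Lemma mppinv_exists (K : realFieldType) m n (A : 'M[K]_(m, n)) :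
  exists X, is_mppinv A X.
Proof.
have [r [B [D [AE]]]] : exists r (B : 'M[K]_(m, r)) (D : 'M[K]_(r, n)),
    [/\ A = B *m D, row_free B^T & row_free D].
  exists (\rank A), (col_base A), (row_base A).
  split; [by rewrite mulmx_base | | exact: row_base_free].
  by rewrite /row_free mxrank_tr; exact: col_base_full.
move=> /unitmx_gram uB /unitmx_gram uD; rewrite trmxK in uB.
have symD : (invmx (D *m D^T))^T = invmx (D *m D^T).
  by rewrite trmx_inv trmx_mul trmxK.
have symB : (invmx (B^T *m B))^T = invmx (B^T *m B).
  by rewrite trmx_inv trmx_mul trmxK.
pose X := D^T *m invmx (D *m D^T) *m invmx (B^T *m B) *m B^T.
have AX : A *m X = B *m invmx (B^T *m B) *m B^T.
  by rewrite AE /X !mulmxA -(mulmxA B D) -(mulmxA B (D *m _)) mulmxV // mulmx1.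
have XA : X *m A = D^T *m invmx (D *m D^T) *m D.
  rewrite AE /X !mulmxA -(mulmxA _ B^T B) -(mulmxA _ _ (B^T *m B)).
  by rewrite mulVmx // mulmx1.
exists X; apply/and4P; split; apply/eqP.
- by rewrite AX AE !mulmxA -(mulmxA _ B^T B) -(mulmxA B) mulVmx // mulmx1.
- rewrite XA /X !mulmxA -(mulmxA _ D D^T) -(mulmxA D^T _ (D *m D^T)).
  by rewrite mulVmx // mulmx1.
- by rewrite AX !trmx_mul trmxK symB mulmxA.
- by rewrite XA !trmx_mul trmxK symD mulmxA.
Qed.

Definition mppinv (K : realFieldType) m n (A : 'M[K]_(m, n)) : 'M[K]_(n, m) :=
  xchoose (mppinv_exists A).

Lemma mppinvP (K : realFieldType) m n (A : 'M[K]_(m, n)) :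
  is_mppinv A (mppinv A).
Proof. exact: xchooseP. Qed.

Lemma mppinv_uniq (K : realFieldType) m n (A : 'M[K]_(m, n)) X :
  is_mppinv A X -> X = mppinv A.
Proof.
move: (mppinv A) (mppinvP A) => Y.
move=> /and4P[/eqP AYA /eqP YAY /eqP AYs /eqP YAs].
move=> /and4P[/eqP AXA /eqP XAX /eqP AXs /eqP XAs].
have AXY : A *m X = A *m Y.
  by rewrite -AXs -{1}AYA -mulmxA trmx_mul AXs AYs !mulmxA AXA.
have XAY : X *m A = Y *m A.
  rewrite -XAs -{1}AYA -!mulmxA mulmxA trmx_mul YAs XAs.
  by rewrite -mulmxA (mulmxA A) AXA.
by rewrite -XAX -mulmxA AXY mulmxA XAY YAY.
Qed.

Definition symmetric_psd (K : realFieldType) n (A : 'M[K]_n) : Prop :=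
  A^T = A /\ forall x : 'cV[K]_n, 0 <= (x^T *m A *m x) 0 0.

(* Right kernel, as a set of column vectors; the columns of [R] may be linearly
   dependent. *)
Definition cols_span_ker (K : realFieldType) m n q (A : 'M[K]_(m, n))
    (R : 'M[K]_(n, q)) : Prop :=
  forall v : 'cV[K]_n, A *m v = 0 <-> exists w : 'cV[K]_q, v = R *m w.

(* [mxdiag] only accepts square blocks; this is the same definition with
   rectangular ones ([conform_mx] acts as the identity on the diagonal). *)
Definition mxdiag_rect (K : realFieldType) k (p q : 'I_k -> nat)
    (R : forall T, 'M[K]_(p T, q T)) : 'M[K]_(\sum_T p T, \sum_T q T) :=
  \mxblock_(S < k, T < k) (if S == T then conform_mx 0 (R S) else 0).

Definition saddle_sol (K : realFieldType) N m (A : 'M[K]_N) (C : 'M[K]_(m, N))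
    (f c : 'cV[K]_N) (lam : 'cV[K]_m) : Prop :=
  A *m c + C^T *m lam = f /\ C *m c = 0.

Definition multiplier_mx (K : realFieldType) N m q (Ap : 'M[K]_N)
    (R : 'M[K]_(N, q)) (C : 'M[K]_(m, N)) : 'M[K]_(m + q) :=
  let H := C *m Ap *m C^T in
  let G := C *m R in
  block_mx H G G^T 0.

Definition multiplier_sol (K : realFieldType) N m q (Ap : 'M[K]_N)
    (R : 'M[K]_(N, q)) (C : 'M[K]_(m, N)) (f c : 'cV[K]_N)
    (lam : 'cV[K]_m) (beta : 'cV[K]_q) : Prop :=
  multiplier_mx Ap R C *m col_mx lam beta
    = col_mx (C *m Ap *m f) (R^T *m f)
  /\ c = Ap *m (f - C^T *m lam) - R *m beta.

(* Main.v *)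
(* Let [g = f - C^T lam].  For symmetric [A] the range of [A] is the orthogonal
   complement of [ker A], so [A c = g] is solvable iff [R^T g = 0] (second block
   row), and its solutions are then [A^+ g - R beta]; substituting them into
   [C c = 0] gives the first block row.  Only the row space of [C] matters for
   [c], because if [C = D Cb] then [C^T lam = Cb^T (D^T lam)]. *)
Require Import Defs.
From mathcomp Require Import all_boot all_order all_algebra.
Import Order.TTheory GRing.Theory Num.Theory.
Local Open Scope ring_scope.

Lemma mul_mxdiag_rect_mxcol (K : realFieldType) k (p q : 'I_k -> nat) n
    (B : forall T, 'M[K]_(p T, q T)) (v : forall T, 'M[K]_(q T, n)) :
  mxdiag_rect B *m \mxcol_T v T = \mxcol_T (B T *m v T).
Proof.
rewrite mul_mxblock_mxrow; apply: eq_mxcol => S.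
rewrite (bigD1 S) //= eqxx conform_mx_id big1 ?addr0 // => T neqTS.
by rewrite eq_sym (negPf neqTS) mul0mx.
Qed.

Lemma mul_mxdiag (K : realFieldType) k (p : 'I_k -> nat)
    (B D : forall T, 'M[K]_(p T)) :
  (\mxdiag_T B T) *m (\mxdiag_T D T) = \mxdiag_T (B T *m D T).
Proof.
rewrite {2}/mxdiag mul_mxdiag_mxblock; apply: eq_mxblock => S T.
by case: eqVneq => [<-|_]; rewrite ?conform_mx_id ?mulmx0.
Qed.

(** Products and transposes of block-diagonal matrices are taken block by block, so each Penrose
    equation reduces to its blocks. *)
Lemma is_mppinv_mxdiag (K : realFieldType) k (p : 'I_k -> nat)
    (A X : forall T, 'M[K]_(p T)) :
  (forall T, is_mppinv (A T) (X T)) ->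
  is_mppinv (\mxdiag_T A T) (\mxdiag_T X T).
Proof.
move=> AX; apply/and4P; rewrite !mul_mxdiag !tr_mxdiag.
by split; apply/eqP/eq_mxdiag => T;
  have /and4P[/eqP ? /eqP ? /eqP ? /eqP ?] := AX T.
Qed.

Lemma cols_span_ker_mxdiag (K : realFieldType) k (p q : 'I_k -> nat)
    (A : forall T, 'M[K]_(p T)) (R : forall T, 'M[K]_(p T, q T)) :
  (forall T, cols_span_ker (A T) (R T)) ->
  cols_span_ker (\mxdiag_T A T) (mxdiag_rect R).
Proof.
move=> AR v; split=> [Av0|[w ->]]; last first.
  rewrite -(submxcolK w) mul_mxdiag_rect_mxcol mul_mxdiag_mxcol -[RHS]mxcol0.
  by apply: eq_mxcol => T; apply/AR; exists (submxcol w T).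
(* The boolean [==] lets [xchoose] select a coefficient vector for each block; stacking these gives
   the global one. *)
have blk T : exists w, submxcol v T == R T *m w.
  suff /AR[w ->] : A T *m submxcol v T = 0 by exists w.
  move: Av0; rewrite -{1}(submxcolK v) mul_mxdiag_mxcol -mxcol0.
  by move=> /eq_mxcolP.
exists (\mxcol_T xchoose (blk T)); rewrite mul_mxdiag_rect_mxcol.
rewrite -{1}(submxcolK v); apply: eq_mxcol => T.
exact/eqP/(xchooseP (blk T)).
Qed.

(** The residual [v = g - A P g] lies in [ker A], since symmetry of [A] and [A P] turns [A P A = A]
    into [A A P = A]. Hence [v] is orthogonal to [g] (by [R^T g = 0]) and to the range of [A], so to
    itself, and it vanishes. *)
Lemma sym_range_ker_orth (K : realFieldType) n q (A P : 'M[K]_n)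
    (R : 'M[K]_(n, q)) (g : 'cV[K]_n) :
  A^T = A -> is_mppinv A P -> cols_span_ker A R ->
  R^T *m g = 0 -> A *m (P *m g) = g.
Proof.
move=> symA /and4P[/eqP APA _ /eqP symAP _] AR Rg.
pose v := g - A *m (P *m g).
have AAP : A *m (A *m P) = A.
  by rewrite -symAP -{1}symA -trmx_mul APA symA.
have Av : A *m v = 0 by rewrite mulmxBr (mulmxA A P) mulmxA AAP subrr.
have vg : v^T *m g = 0.
  by have /AR[w ->] := Av; rewrite trmx_mul -mulmxA Rg mulmx0.
have vA : v^T *m A = 0 by rewrite -{1}symA -trmx_mul Av trmx0.
have /(congr1 trmx) : v^T = 0.
  apply: mulmx_tr_eq0; rewrite trmxK {2}/v mulmxBr vg.
  by rewrite (mulmxA v^T A) vA mul0mx subrr.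
by rewrite trmxK trmx0 => /eqP; rewrite subr_eq0 => /eqP <-.
Qed.

(** Once [c] is given by its formula, [C c] is the right-hand side minus the left-hand side of the
    first block row. *)
Lemma multiplier_solE (K : realFieldType) n m q (P : 'M[K]_n)
    (R : 'M[K]_(n, q)) (C : 'M[K]_(m, n)) (f c : 'cV[K]_n)
    (lam : 'cV[K]_m) (beta : 'cV[K]_q) :
  multiplier_sol P R C f c lam beta <->
  [/\ C *m c = 0, R^T *m (f - C^T *m lam) = 0
    & c = P *m (f - C^T *m lam) - R *m beta].
Proof.
rewrite /multiplier_sol /multiplier_mx mul_block_col mul0mx addr0 trmx_mul.
split=> [[/eq_col_mx[row1 row2] cE]|[Cc Rg cE]]; split=> //.
- rewrite cE !mulmxBr !mulmxA -row1; apply/eqP.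
  by rewrite addrAC addrK subrr.
- by rewrite mulmxBr mulmxA row2 subrr.
- congr col_mx; last first.
    by apply/eqP; rewrite eq_sym -subr_eq0 -mulmxA -mulmxBr Rg.
  apply/eqP; rewrite eq_sym -subr_eq0 opprD addrA -Cc cE.
  by rewrite !mulmxBr !mulmxA.
Qed.

Lemma saddle_multiplier (K : realFieldType) n m q (A P : 'M[K]_n)
    (R : 'M[K]_(n, q)) (C : 'M[K]_(m, n)) (f c : 'cV[K]_n) (lam : 'cV[K]_m) :
  A^T = A -> is_mppinv A P -> cols_span_ker A R ->
  saddle_sol A C f c lam <-> exists beta, multiplier_sol P R C f c lam beta.
Proof.
move=> symA AP AR; have /and4P[/eqP APA _ _ _] := AP.
have AR0 : forall w : 'cV_q, A *m (R *m w) = 0 by move=> w; apply/AR; exists w.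
split=> [[AcE Cc]|[beta /multiplier_solE[Cc Rg cE]]]; last first.
  have Ag := sym_range_ker_orth _ _ _ _ _ _ _ symA AP AR Rg.
  by split=> //; rewrite cE mulmxBr AR0 subr0 Ag subrK.
have gE : f - C^T *m lam = A *m c by rewrite -AcE addrK.
(* The witness [beta] consists of coefficients of the kernel vector [P A c - c] in the columns of
   [R]; this order of subtraction matches the sign in [c = P g - R beta]. *)
have /AR[w wE] : A *m (P *m (A *m c) - c) = 0.
  by rewrite mulmxBr !mulmxA APA subrr.
exists w; apply/multiplier_solE; rewrite gE -wE opprB addrC subrK; split=> //.
(* Testing on unit vectors gives [A R = 0]; transposing, [R^T A = 0], which is the second block row
   because [g = A c]. *)
have AR0' : A *m R = 0.
  apply/matrixP => i j; have /matrixP/(_ i 0) := AR0 (delta_mx j 0).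
  by rewrite mulmxA -colE !mxE.
by rewrite mulmxA -{1}symA -trmx_mul AR0' trmx0 mul0mx.
Qed.

(** Both blocks acting on [eta], [C P C^T] and [R^T C^T], end in the factor [C^T]. *)
Lemma multiplier_mx_null (K : realFieldType) n m q (P : 'M[K]_n)
    (R : 'M[K]_(n, q)) (C : 'M[K]_(m, n)) (eta : 'cV[K]_m) :
  C^T *m eta = 0 -> multiplier_mx P R C *m col_mx eta 0 = 0.
Proof.
move=> Ceta; rewrite /multiplier_mx mul_block_col !mulmx0 !addr0 trmx_mul.
by rewrite -!mulmxA Ceta !mulmx0 col_mx0.
Qed.

Lemma eqmx_saddle_sol (K : realFieldType) n m r (A : 'M[K]_n)
    (C : 'M[K]_(m, n)) (D : 'M[K]_(r, n)) (f c : 'cV[K]_n) :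
  (C == D)%MS -> (exists lam, saddle_sol A C f c lam) ->
  exists lam, saddle_sol A D f c lam.
Proof.
move=> /andP[/submxP[X CE] /submxP[Y DE]] [lam [AcE Cc]].
(* [C = X D] moves [X^T] into the multiplier and keeps [c]; [D = Y C] carries the constraint
   over. *)
exists (X^T *m lam); split; last by rewrite DE -mulmxA Cc mulmx0.
by rewrite mulmxA -trmx_mul -CE.
Qed.

Theorem proposition6p4 (K : realType) (k : nat) (p q : 'I_k -> nat)
    (A_ : forall T : 'I_k, 'M[K]_(p T))
    (R_ : forall T : 'I_k, 'M[K]_(p T, q T))
    (m : nat) (C : 'M[K]_(m, \sum_T p T)) (f : 'cV[K]_(\sum_T p T)) :
  let A := \mxdiag_T A_ T in
  let Ap := \mxdiag_T mppinv (A_ T) in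
  let R := mxdiag_rect R_ in
  symmetric_psd A ->
  (forall T, cols_span_ker (A_ T) (R_ T)) ->
  [/\ (forall c lam, saddle_sol A C f c lam <->
         exists beta, multiplier_sol Ap R C f c lam beta),
      (forall eta : 'cV[K]_m, C^T *m eta = 0 ->
         multiplier_mx Ap R C *m col_mx eta 0 = 0),
      (~~ row_free C -> exists eta : 'cV[K]_m,
         [/\ eta != 0, C^T *m eta = 0 &
             multiplier_mx Ap R C *m col_mx eta 0 = 0]),
      (exists (r : nat) (Cb : 'M[K]_(r, \sum_T p T)),
         row_free Cb /\ (Cb == C)%MS) &
      (forall (r : nat) (Cb : 'M[K]_(r, \sum_T p T)),
         row_free Cb -> (Cb == C)%MS ->
         forall c,
           ((exists lam, saddle_sol A C f c lam) <->
            (exists lam, saddle_sol A Cb f c lam)) /\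
           ((exists lam beta, multiplier_sol Ap R C f c lam beta) <->
            (exists lam beta, multiplier_sol Ap R Cb f c lam beta)))].
Proof.
move=> A Ap R [symA _] kerR.
have AAp : is_mppinv A Ap by apply: is_mppinv_mxdiag => T; apply: mppinvP.
have AR : cols_span_ker A R by apply: cols_span_ker_mxdiag.
have equiv s (D : 'M_(s, _)) c lam :
    saddle_sol A D f c lam <-> exists beta, multiplier_sol Ap R D f c lam beta.
  exact: saddle_multiplier.
split.
- by move=> c lam; apply: equiv.
- by move=> eta; apply: multiplier_mx_null.
(* A nontrivial dependency among the rows of [C] is a nonzero row [v] with [v C = 0]; its transpose
   is [eta]. *)
- rewrite -kermx_eq0 => /rowV0Pn[v /sub_kermxP vC v0].
  have CvT : C^T *m v^T = 0 by rewrite -trmx_mul vC trmx0.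
  exists v^T; split=> //; last exact: multiplier_mx_null.
  by rewrite -trmx0 (inj_eq trmx_inj).
- exists (\rank C), (row_base C); split; first exact: row_base_free.
  by apply/eqmxP/eq_row_base.
- move=> r Cb _ CbC c.
  have CCb : (C == Cb)%MS by rewrite andbC.
  have saddle_iff : (exists lam, saddle_sol A C f c lam) <->
      (exists lam, saddle_sol A Cb f c lam).
    by split; apply: eqmx_saddle_sol.
  (* The two block systems are compared through their saddle problems, as [equiv] holds for every
     constraint matrix; [lam] and [beta] may change, [c] does not. *)
  split=> //; split=> -[lam /equiv sol].
  + have /saddle_iff[lam' /equiv] : exists lam, saddle_sol A C f c lam
      by exists lam.
    by exists lam'.
  + have /saddle_iff[lam' /equiv] : exists lam, saddle_sol A Cb f c lam
      by exists lam.
    by exists lam'.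
Qed.
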